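(* For real parameters $\lambda>\mu>0$, let $v_{\mu,\lambda}\in\mathcal{C}^2([0,1])$ be the unique solution of $$v_{\mu,\lambda}''(r)=\frac{\mu\, e^{v_{\mu,\lambda}(r)}}{\int_0^1e^{v_{\mu,\lambda}(s)}\,\mathrm{d}s}-\frac{\lambda\, e^{-v_{\mu,\lambda}(r)}}{\int_0^1e^{-v_{\mu,\lambda}(s)}\,\mathrm{d}s},\quad r\in(0,1),\qquad v_{\mu,\lambda}(0)=v_{\mu,\lambda}'(0)=0,$$ and let $u_{\lambda}\in\mathcal{C}^2([0,1])$ be the unique solution of $$-u_{\lambda}''(r)=\frac{\lambda\, e^{-u_{\lambda}(r)}}{\int_0^1 e^{-u_{\lambda}(s)}\,\mathrm{d}s},\quad r\in(0,1),\qquad u_{\lambda}(0)=u_{\lambda}'(0)=0.$$ Then both $v_{\mu,\lambda}$ and $u_{\lambda}$ are monotonically decreasing on $[0,1]$, but $v_{\mu,\lambda}-u_{\lambda}$ is monotonically increasing on $[0,1]$. Moreover: (a) Assume that $\mu=\mu(\lambda)$ depends on $\lambda$ and $\lim_{\lambda\to\infty}\mu\lambda=0$. Then $\lim_{\lambda\to\infty}\|v_{\mu,\lambda}-u_{\lambda}\|_{\mathcal{C}^1([0,1])}=0$. (b) For each fixed $\lambda>0$, $\lim_{\mu\to0^+}\|v_{\mu,\lambda}-u_{\lambda}\|_{\mathcal{C}^1([0,1])}=0$.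
   Context: The norm is $\|f\|_{\mathcal{C}^1([0,1])}:=\sup_{[0,1]}(|f|+|f'|)$. Existence and uniqueness of the $\mathcal{C}^2([0,1])$ solutions $v_{\mu,\lambda}$ (for $\lambda>\mu>0$) and $u_\lambda$ (for $\lambda>0$) are known facts and are taken as given. In (a), $\mu=\mu(\lambda)$ is any positive function of $\lambda$ with $0<\mu(\lambda)<\lambda$. *)

(* Defs.v *)
From Stdlib Require Import Reals.
From Coquelicot Require Import Coquelicot.
Open Scope R_scope.

Definition I01 (x : R) : Prop := 0 <= x <= 1.

(* The difference quotients are only taken at points of [0,1], so the
   derivative is one-sided at 0 and 1; Coquelicot's [Derive] would look at
   the values outside [0,1]. *)
Definition is_derive01 (f : R -> R) (x l : R) : Prop :=
  filterlim (fun y => (f y - f x) / (y - x))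
            (within I01 (locally' x)) (locally l).

Definition ex_derive01 (f : R -> R) (x : R) : Prop :=
  exists l, is_derive01 f x l.

(* Total operator, meaningful when [ex_derive01 f x] and [I01 x]. *)
Definition Derive01 (f : R -> R) (x : R) : R := iota (is_derive01 f x).

Definition C2_01 (f : R -> R) : Prop :=
  (forall x, I01 x -> ex_derive01 f x) /\
  (forall x, I01 x -> ex_derive01 (Derive01 f) x) /\
  continuous_on I01 (Derive01 (Derive01 f)).

(* The supremum is finite when f is of class C^1 on [0,1], so the projection
   [real] loses nothing there. *)
Definition C1_norm (f : R -> R) : R :=
  real (Lub_Rbar (fun y => exists r, I01 r /\ y = Rabs (f r) + Rabs (Derive01 f r))).

Definition v_solution (mu lambda : R) (v : R -> R) : Prop :=
  C2_01 v /\
  (forall r, 0 < r < 1 ->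
     Derive01 (Derive01 v) r =
       mu * exp (v r) / RInt (fun s => exp (v s)) 0 1
       - lambda * exp (- v r) / RInt (fun s => exp (- v s)) 0 1) /\
  v 0 = 0 /\ Derive01 v 0 = 0.

Definition u_solution (lambda : R) (u : R -> R) : Prop :=
  C2_01 u /\
  (forall r, 0 < r < 1 ->
     - Derive01 (Derive01 u) r =
       lambda * exp (- u r) / RInt (fun s => exp (- u s)) 0 1) /\
  u 0 = 0 /\ Derive01 u 0 = 0.

Definition decreasing01 (f : R -> R) : Prop :=
  forall x y, I01 x -> I01 y -> x < y -> f y < f x.

Definition increasing01 (f : R -> R) : Prop :=
  forall x y, I01 x -> I01 y -> x < y -> f x < f y.

(* Main.v *)
(* Write w = v - u, a = mu / int e^v, b = lambda / int e^(-v),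
   c = lambda / int e^(-u).

   If a >= b, a comparison argument gives v >= 0, hence int e^v >= int e^(-v)
   and a < b, a contradiction; so a < b, and comparison applied to -v gives
   v <= 0, hence v'' < 0.  The function u is the case mu = 0.

   By conservation of energy, w'' = 2 a e^v + c - a - b wherever w' = 0, and
   this is strictly decreasing in r.  As w'(0) = 0 < mu = w'(1), a point with
   w' < 0 would lie between two zeros of w' with w'' <= 0 at the first and
   w'' >= 0 at the second, which is impossible.  So w is increasing.

   Finally w'' = a e^v + e^(-v) (c e^w - b).  Since w increases, the last term
   changes sign from negative to positive; its integral over [0,1] is
   lambda - lambda = 0, so its integrals over [0,r] are nonpositive and
   w' <= a int e^v = mu.  Thus the C^1 norm of w is at most 2 mu. *)
Require Import Defs.
From Stdlib Require Import Reals Lra Classical.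
From Coquelicot Require Import Coquelicot.
Open Scope R_scope.

(** * Extension from [0,1] to the line, and derivatives relative to [0,1] *)

(** The retraction of the line onto [0,1]. Precomposing with it turns continuity relative to [0,1]
    into continuity on all of [R]. *)
Definition clamp01 (x : R) : R := Rmax 0 (Rmin 1 x).

Lemma clamp01_I01 (x : R) : I01 (clamp01 x).
Proof.
  unfold I01, clamp01, Rmax, Rmin; repeat destruct Rle_dec; lra.
Qed.

Lemma clamp01_id (x : R) : I01 x -> clamp01 x = x.
Proof.
  unfold I01, clamp01, Rmax, Rmin; repeat destruct Rle_dec; lra.
Qed.

Lemma clamp01_lipschitz (x y : R) : Rabs (clamp01 y - clamp01 x) <= Rabs (y - x).
Proof.
  unfold clamp01, Rmax, Rmin, Rabs;
    repeat destruct Rle_dec; repeat destruct Rcase_abs; lra.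
Qed.

Lemma continuous_clamp01 (f : R -> R) (x : R) :
  continuous_on I01 f -> continuous (fun y => f (clamp01 y)) x.
Proof.
  intros Hf. apply (filterlim_comp _ _ _ clamp01 f _ (within I01 (locally (clamp01 x)))).
  - intros P [d Hd]. exists d. intros y Hy. apply Hd.
    + apply Rle_lt_trans with (2 := Hy). apply clamp01_lipschitz.
    + apply clamp01_I01.
  - apply Hf, clamp01_I01.
Qed.

(** A short step to the right from the left half, or to the left from the right half, stays in
    [0,1]. Properness makes limits along this filter unique, so the [iota] in [Derive01] picks the
    actual derivative. *)
Lemma within01_punctured_proper (x : R) :
  I01 x -> ProperFilter' (within I01 (locally' x)).
Proof.
  intros Hx. constructor.
  - intros [d Hd]. pose proof (cond_pos d) as Hdp.
    set (e := Rmin d 1 / 2).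
    assert (He : 0 < e <= 1 / 2 /\ e < d).
    { unfold e, Rmin; destruct Rle_dec; lra. }
    unfold I01 in *.
    destruct (Rle_dec x (1 / 2)).
    + apply (Hd (x + e)); [ | lra | split; lra].
      change (Rabs (x + e - x) < d). apply Rabs_def1; lra.
    + apply (Hd (x - e)); [ | lra | split; lra].
      change (Rabs (x - e - x) < d). apply Rabs_def1; lra.
  - apply within_filter, locally'_filter.
Qed.

Lemma is_derive01_eps (f : R -> R) (x l : R) :
  is_derive01 f x l <->
  (forall eps : posreal, exists d : posreal, forall y,
     I01 y -> y <> x -> Rabs (y - x) < d ->
     Rabs ((f y - f x) / (y - x) - l) < eps).
Proof.
  split.
  - intros H eps.
    destruct (proj1 (filterlim_locally _ _) H eps) as [d Hd].
    exists d. intros y Hy Hne Hyd. exact (Hd y Hyd Hne Hy).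
  - intros H. apply filterlim_locally. intros eps.
    destruct (H eps) as [d Hd]. exists d.
    intros y Hyd Hne Hy. exact (Hd y Hy Hne Hyd).
Qed.

Lemma is_derive01_Derive01 (f : R -> R) (x l : R) :
  I01 x -> is_derive01 f x l -> Derive01 f x = l.
Proof.
  intros Hx Hl. pose proof (within01_punctured_proper x Hx).
  apply (iota_filterlim_locally _ _ Hl).
Qed.

Lemma ex_derive01_Derive01 (f : R -> R) (x : R) :
  I01 x -> ex_derive01 f x -> is_derive01 f x (Derive01 f x).
Proof.
  intros Hx [l Hl]. rewrite (is_derive01_Derive01 f x l Hx Hl). exact Hl.
Qed.

Lemma is_derive_is_derive01 (f : R -> R) (x l : R) :
  is_derive f x l -> is_derive01 f x l.
Proof.
  intros H%is_derive_Reals. apply is_derive01_eps. intros eps.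
  destruct (H eps (cond_pos eps)) as [d Hd]. exists d.
  intros y _ Hne Hyd.
  specialize (Hd (y - x)). replace (x + (y - x)) with y in Hd by ring.
  apply Hd; [lra | exact Hyd].
Qed.

Lemma is_derive01_is_derive (f : R -> R) (x l : R) :
  0 < x < 1 -> is_derive01 f x l -> is_derive f x l.
Proof.
  intros Hx H. apply is_derive_Reals. intros eps Heps.
  destruct (proj1 (is_derive01_eps f x l) H (mkposreal eps Heps)) as [d Hd].
  pose proof (cond_pos d).
  assert (Hm : 0 < Rmin d (Rmin x (1 - x))).
  { repeat apply Rmin_pos; lra. }
  exists (mkposreal _ Hm). simpl. intros h Hh Hlt.
  pose proof (Rmin_l d (Rmin x (1 - x))).
  pose proof (Rmin_r d (Rmin x (1 - x))).
  pose proof (Rmin_l x (1 - x)). pose proof (Rmin_r x (1 - x)).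
  specialize (Hd (x + h)). replace (x + h - x) with h in Hd by ring.
  apply Rabs_def2 in Hlt as Hlt'.
  apply Hd; [unfold I01 | | ]; lra.
Qed.

Lemma is_derive01_ext (f g : R -> R) (x l : R) :
  I01 x -> (forall y, I01 y -> f y = g y) -> is_derive01 f x l -> is_derive01 g x l.
Proof.
  intros Hx Hfg. rewrite !is_derive01_eps. intros H eps.
  destruct (H eps) as [d Hd]. exists d. intros y Hy Hne Hyd.
  rewrite <- !Hfg; auto.
Qed.

Lemma is_derive01_minus (f g : R -> R) (x l m : R) :
  is_derive01 f x l -> is_derive01 g x m ->
  is_derive01 (fun y => f y - g y) x (l - m).
Proof.
  rewrite !is_derive01_eps. intros Hf Hg eps.
  destruct (Hf (pos_div_2 eps)) as [d1 H1].
  destruct (Hg (pos_div_2 eps)) as [d2 H2].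
  assert (Hm : 0 < Rmin d1 d2) by (apply Rmin_pos; apply cond_pos).
  exists (mkposreal _ Hm). simpl. intros y Hy Hne Hyd.
  specialize (H1 y Hy Hne (Rlt_le_trans _ _ _ Hyd (Rmin_l _ _))).
  specialize (H2 y Hy Hne (Rlt_le_trans _ _ _ Hyd (Rmin_r _ _))).
  simpl in *. apply Rabs_def2 in H1. apply Rabs_def2 in H2.
  replace ((f y - g y - (f x - g x)) / (y - x))
    with ((f y - f x) / (y - x) - (g y - g x) / (y - x)) by (field; lra).
  apply Rabs_def1; lra.
Qed.

(** Close to [x] the difference quotient is at most [K = |df x| + 1] in absolute value, so
    [|f y - f x| <= K |y - x|] there. *)
Lemma is_derive01_continuous_on (f df : R -> R) :
  (forall x, I01 x -> is_derive01 f x (df x)) -> continuous_on I01 f.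
Proof.
  intros H x Hx. apply filterlim_locally. intros eps.
  destruct (proj1 (is_derive01_eps _ _ _) (H x Hx) (mkposreal 1 Rlt_0_1)) as [d Hd].
  set (K := Rabs (df x) + 1). pose proof (Rabs_pos (df x)).
  pose proof (cond_pos eps) as Heps.
  assert (Hm : 0 < Rmin d (eps / K)).
  { apply Rmin_pos; [apply cond_pos | apply Rdiv_lt_0_compat; unfold K; lra]. }
  exists (mkposreal _ Hm). intros y Hyd Hy.
  change (Rabs (y - x) < Rmin d (eps / K)) in Hyd.
  change (Rabs (f y - f x) < eps).
  destruct (Req_dec y x) as [-> | Hne].
  { rewrite Rminus_diag, Rabs_R0. exact Heps. }
  specialize (Hd y Hy Hne (Rlt_le_trans _ _ _ Hyd (Rmin_l _ _))). simpl in Hd.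
  replace (f y - f x) with ((f y - f x) / (y - x) * (y - x)) by (field; lra).
  rewrite Rabs_mult.
  apply Rle_lt_trans with (K * Rabs (y - x)).
  - apply Rmult_le_compat_r; [apply Rabs_pos | ]. unfold K.
    pose proof (Rabs_triang_inv ((f y - f x) / (y - x)) (df x)). lra.
  - apply Rmult_lt_reg_l with (/ K); [apply Rinv_0_lt_compat; unfold K; lra | ].
    rewrite <- Rmult_assoc, Rinv_l, Rmult_1_l by (unfold K; lra).
    rewrite Rmult_comm. exact (Rlt_le_trans _ _ _ Hyd (Rmin_r _ _)).
Qed.

Lemma continuous_derive (f : R -> R) (x l : R) : is_derive f x l -> continuous f x.
Proof.
  intros H. apply (ex_derive_continuous (K := R_AbsRing) (V := R_NormedModule)).
  now exists l.
Qed.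

(** * Primitives and the passage to two-sided derivatives *)

Lemma is_derive_primitive0 (g : R -> R) (x : R) :
  (forall y, continuous g y) -> is_derive (fun y => RInt g 0 y) x (g x).
Proof.
  intros Hg. apply (is_derive_RInt g _ 0); [ | apply Hg].
  apply filter_forall. intros y. apply (@RInt_correct R_CompleteNormedModule).
  apply (ex_RInt_continuous (V := R_CompleteNormedModule)). intros z _. apply Hg.
Qed.

(** Trades a function differentiable relative to [0,1] for one with two-sided derivatives
    everywhere, so that the usual calculus applies up to the endpoints. The integral of [G], started
    at [f 0], differs from [f] by a function with zero derivative inside [0,1]. *)
Lemma is_derive01_primitive (f G : R -> R) :
  (forall x, I01 x -> is_derive01 f x (G x)) -> (forall x, continuous G x) ->
  exists F : R -> R,
    (forall x, is_derive F x (G x)) /\ (forall x, I01 x -> F x = f x).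
Proof.
  intros Hf HG.
  set (F := fun x => f 0 + RInt G 0 x).
  assert (HF : forall x, is_derive F x (G x)).
  { intros x. unfold F. evar_last.
    - apply (is_derive_plus (fun _ : R => f 0) (fun x => RInt G 0 x)).
      + apply is_derive_const.
      + exact (is_derive_primitive0 G x HG).
    - apply plus_zero_l. }
  exists F. split; [exact HF | ].
  intros x Hx.
  (* Clamping makes the difference continuous in the two-sided sense at 0 and 1 too, as the mean
     value theorem requires. *)
  set (D := fun y => F (clamp01 y) - f (clamp01 y)).
  assert (HD : forall y, continuity_pt D y).
  { intros y. apply continuity_pt_filterlim.
    apply (continuous_clamp01 (fun y => F y - f y)).
    apply (is_derive01_continuous_on _ (fun y => G y - G y)).
    intros z Hz. apply is_derive01_minus; [apply is_derive_is_derive01, HF | auto]. }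
  destruct (MVT_gen D 0 x (fun _ => 0)) as [c [_ Hc]].
  - intros y. unfold I01 in Hx. rewrite Rmin_left, Rmax_right by lra. intros Hy.
    apply is_derive_ext_loc with (fun y => F y - f y).
    + exists (mkposreal (Rmin y (1 - y)) ltac:(apply Rmin_pos; lra)).
      intros z Hz. change (Rabs (z - y) < Rmin y (1 - y)) in Hz.
      pose proof (Rmin_l y (1 - y)). pose proof (Rmin_r y (1 - y)).
      apply Rabs_def2 in Hz. unfold D. rewrite clamp01_id; [easy | unfold I01; lra].
    + replace 0 with (G y - G y) by ring. apply (is_derive_minus F f y (G y) (G y)); [apply HF | ].
      apply is_derive01_is_derive; [lra | apply Hf; unfold I01; lra].
  - intros y _. apply HD.
  - unfold D in Hc. rewrite (clamp01_id x Hx), (clamp01_id 0) in Hc by (unfold I01; lra).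
    assert (F 0 = f 0).
    { unfold F. rewrite RInt_point. exact (Rplus_0_r _). }
    lra.
Qed.

(** Carries the differential equation, stated on the open interval only, to the endpoints: every
    point of [0,1] has points of (0,1) arbitrarily close. *)
Lemma continuous_eq_closure01 (g h : R -> R) :
  (forall x, continuous g x) -> (forall x, continuous h x) ->
  (forall x, 0 < x < 1 -> g x = h x) -> forall x, I01 x -> g x = h x.
Proof.
  intros Hg Hh Heq x Hx.
  apply Rminus_diag_uniq. apply NNPP. intros Hne.
  assert (Hpos : 0 < Rabs (g x - h x)) by (apply Rabs_pos_lt, Hne).
  assert (Hc : continuous (fun y => g y - h y) x).
  { apply (continuous_minus g h); auto. }
  destruct (proj1 (filterlim_locally _ _) Hc (mkposreal _ Hpos)) as [d Hd].
  pose proof (cond_pos d).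
  set (e := Rmin d 1 / 4).
  assert (He : 0 < e <= 1 / 4 /\ e < d).
  { unfold e, Rmin; destruct Rle_dec; lra. }
  assert (Hfar : forall y, 0 < y < 1 -> ~ Rabs (y - x) < d).
  { intros y Hy Hyd. specialize (Hd y Hyd).
    change (Rabs (g y - h y - (g x - h x)) < Rabs (g x - h x)) in Hd.
    rewrite (Heq y Hy) in Hd.
    replace (h y - h y - (g x - h x)) with (- (g x - h x)) in Hd by ring.
    rewrite Rabs_Ropp in Hd. lra. }
  unfold I01 in Hx. destruct (Rle_dec x (1 / 2)).
  - apply (Hfar (x + e)); [lra | apply Rabs_def1; lra].
  - apply (Hfar (x - e)); [lra | apply Rabs_def1; lra].
Qed.

(** * The nonlocal problem as a system with constant coefficients *)

(** The nonlocal factors are frozen into constants [a] and [b], and the integrals become primitives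
    [E] and [F]. The conditions on [a * E 1] and [b * F 1] retain the nonlocal normalisation. The
    value [mu = 0] describes [u]. *)
Record mean_field (mu lambda a b : R) (y p E F : R -> R) : Prop := {
  mf_y : forall r, I01 r -> is_derive y r (p r);
  mf_p : forall r, I01 r -> is_derive p r (a * exp (y r) - b * exp (- y r));
  mf_E : forall r, I01 r -> is_derive E r (exp (y r));
  mf_F : forall r, I01 r -> is_derive F r (exp (- y r));
  mf_y0 : y 0 = 0;
  mf_p0 : p 0 = 0;
  mf_E0 : E 0 = 0;
  mf_F0 : F 0 = 0;
  mf_E1 : a * E 1 = mu;
  mf_F1 : b * F 1 = lambda
}.

Lemma MVT01 (f df : R -> R) (x y : R) :
  (forall r, I01 r -> is_derive f r (df r)) -> I01 x -> I01 y -> x < y ->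
  exists c, x < c < y /\ f y - f x = df c * (y - x).
Proof.
  unfold I01. intros Hf Hx Hy Hxy.
  destruct (MVT_cor2 f df x y Hxy) as [c [H1 H2]].
  - intros c Hc. apply is_derive_Reals, Hf. lra.
  - exists c. auto.
Qed.

Lemma derive01_ge0 (f df : R -> R) :
  (forall r, I01 r -> is_derive f r (df r)) -> (forall r, I01 r -> 0 <= df r) ->
  forall x y, I01 x -> I01 y -> x <= y -> f x <= f y.
Proof.
  intros Hf Hd x y Hx Hy [Hxy | ->]; [ | lra].
  destruct (MVT01 f df x y Hf Hx Hy Hxy) as [c [Hc H]].
  assert (0 <= df c) by (apply Hd; unfold I01 in *; lra). nra.
Qed.

Lemma derive01_gt0 (f df : R -> R) :
  (forall r, I01 r -> is_derive f r (df r)) -> (forall r, 0 < r < 1 -> 0 < df r) ->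
  forall x y, I01 x -> I01 y -> x < y -> f x < f y.
Proof.
  intros Hf Hd x y Hx Hy Hxy.
  destruct (MVT01 f df x y Hf Hx Hy Hxy) as [c [Hc H]].
  assert (0 < df c) by (apply Hd; unfold I01 in *; lra). nra.
Qed.

Lemma derive01_0 (f : R -> R) :
  (forall r, I01 r -> is_derive f r 0) -> forall x, I01 x -> f x = f 0.
Proof.
  intros Hf x Hx. unfold I01 in *.
  destruct (Req_dec x 0) as [-> | Hne]; [easy | ].
  destruct (MVT01 f (fun _ => 0) 0 x Hf) as [c [_ Hc]]; unfold I01; lra.
Qed.

Lemma primitive01_gt0 (E g : R -> R) :
  (forall r, I01 r -> is_derive E r (g r)) -> (forall r, 0 < g r) -> E 0 = 0 -> 0 < E 1.
Proof.
  intros HE Hg H0. rewrite <- H0.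
  apply (derive01_gt0 E g); auto; unfold I01; lra.
Qed.

Lemma v_solution_mean_field (mu lambda : R) (v : R -> R) :
  v_solution mu lambda v ->
  exists a b y p E F, mean_field mu lambda a b y p E F /\
    (forall r, I01 r -> y r = v r).
Proof.
  intros [[Hv1 [Hv2 Hv3]] [Hode [Hv0 Hp0]]].
  assert (Dv : forall x, I01 x -> is_derive01 v x (Derive01 v x)).
  { intros x Hx. apply ex_derive01_Derive01; auto. }
  assert (Dp : forall x, I01 x ->
    is_derive01 (Derive01 v) x (Derive01 (Derive01 v) x)).
  { intros x Hx. apply ex_derive01_Derive01; auto. }
  (* The extension starts from the continuous second derivative; two integrations then give [p] and
     [y] on the whole line. *)
  set (q := fun x => Derive01 (Derive01 v) (clamp01 x)).
  destruct (is_derive01_primitive (Derive01 v) q) as [p [Hp Hpv]].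
  { intros x Hx. unfold q. rewrite clamp01_id by exact Hx. auto. }
  { intros x. apply continuous_clamp01, Hv3. }
  destruct (is_derive01_primitive v p) as [y [Hy Hyv]].
  { intros x Hx. rewrite Hpv by exact Hx. auto. }
  { intros x. exact (continuous_derive _ _ _ (Hp x)). }
  assert (Cy : forall x, continuous y x).
  { intros x. exact (continuous_derive _ _ _ (Hy x)). }
  assert (CE : forall x, continuous (fun r => exp (y r)) x).
  { intros x. apply (continuous_comp y exp); [auto | ].
    exact (continuous_derive _ _ _ (is_derive_exp _)). }
  assert (CF : forall x, continuous (fun r => exp (- y r)) x).
  { intros x. apply (continuous_comp (fun r => - y r) exp).
    - apply (continuous_opp y). auto.
    - exact (continuous_derive _ _ _ (is_derive_exp _)). }
  set (E := fun r : R => RInt (fun s => exp (y s)) 0 r).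
  set (F := fun r : R => RInt (fun s => exp (- y s)) 0 r).
  assert (HE : forall r, is_derive E r (exp (y r))).
  { intros r. exact (is_derive_primitive0 _ r CE). }
  assert (HF : forall r, is_derive F r (exp (- y r))).
  { intros r. exact (is_derive_primitive0 _ r CF). }
  assert (E0 : E 0 = 0) by exact (RInt_point 0 (fun s => exp (y s))).
  assert (F0 : F 0 = 0) by exact (RInt_point 0 (fun s => exp (- y s))).
  assert (E1 : 0 < E 1).
  { apply (primitive01_gt0 E (fun r => exp (y r))); auto using exp_pos. }
  assert (F1 : 0 < F 1).
  { apply (primitive01_gt0 F (fun r => exp (- y r))); auto using exp_pos. }
  assert (HE1 : RInt (fun s => exp (v s)) 0 1 = E 1).
  { apply RInt_ext. intros r. rewrite Rmin_left, Rmax_right by lra. intros Hr.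
    rewrite Hyv; [easy | unfold I01; lra]. }
  assert (HF1 : RInt (fun s => exp (- v s)) 0 1 = F 1).
  { apply RInt_ext. intros r. rewrite Rmin_left, Rmax_right by lra. intros Hr.
    rewrite Hyv; [easy | unfold I01; lra]. }
  set (a := mu / E 1). set (b := lambda / F 1).
  (* [mf_p] asks for the equation on closed [0,1], endpoints included. *)
  assert (Hq : forall x, I01 x -> q x = a * exp (y x) - b * exp (- y x)).
  { apply continuous_eq_closure01.
    - intros x. apply continuous_clamp01, Hv3.
    - intros x. apply (continuous_minus (fun r => a * exp (y r)) (fun r => b * exp (- y r))).
      + apply (continuous_scal_r a (fun r => exp (y r))), CE.
      + apply (continuous_scal_r b (fun r => exp (- y r))), CF.
    - intros x Hx. assert (HI : I01 x) by (unfold I01; lra).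
      unfold q. rewrite clamp01_id by exact HI.
      rewrite Hode, HE1, HF1, <- Hyv by assumption.
      unfold a, b. field. split; lra. }
  exists a, b, y, p, E, F. split; [constructor | exact Hyv]; auto.
  - intros r Hr. rewrite <- Hq by exact Hr. apply Hp.
  - rewrite Hyv; [exact Hv0 | unfold I01; lra].
  - rewrite Hpv; [exact Hp0 | unfold I01; lra].
  - unfold a. field. lra.
  - unfold b. field. lra.
Qed.

Lemma u_solution_v_solution (lambda : R) (u : R -> R) :
  u_solution lambda u -> v_solution 0 lambda u.
Proof.
  intros [HC [Hode H0]]. split; [exact HC | split; [ | exact H0]].
  intros r Hr. rewrite <- (Ropp_involutive (Derive01 _ r)), (Hode r Hr).
  unfold Rdiv. ring.
Qed.

(** * Comparison for second-order equations *)

(** Squaring removes the kink of the negative part at 0. The difference quotient errs by at most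
    [|h|], hence [eps] itself serves as radius. *)
Lemma is_derive_sqr_min0 (x : R) :
  is_derive (fun t => Rmin t 0 ^ 2) x (2 * Rmin x 0).
Proof.
  apply is_derive_Reals. intros eps Heps. exists (mkposreal eps Heps). simpl.
  intros h Hh Hlt.
  apply Rle_lt_trans with (2 := Hlt).
  assert (HR : 0 < Rabs h) by (apply Rabs_pos_lt, Hh).
  apply Rmult_le_reg_r with (1 := HR).
  rewrite <- !Rabs_mult, (Rabs_pos_eq (h * h)) by nra.
  replace (((Rmin (x + h) 0 * (Rmin (x + h) 0 * 1) - Rmin x 0 * (Rmin x 0 * 1)) / h
            - 2 * Rmin x 0) * h)
    with (Rmin (x + h) 0 ^ 2 - Rmin x 0 ^ 2 - 2 * Rmin x 0 * h) by (field; exact Hh).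
  unfold Rmin; repeat destruct Rle_dec; apply Rabs_le; nra.
Qed.

(* Gronwall's inequality for [min (y, 0)^2 + min (p, 0)^2]. *)
Lemma second_order_comparison (y p q : R -> R) (K : R) :
  0 <= K ->
  (forall r, I01 r -> is_derive y r (p r)) ->
  (forall r, I01 r -> is_derive p r (q r)) ->
  y 0 = 0 -> p 0 = 0 ->
  (forall r, I01 r -> K * Rmin (y r) 0 <= q r) ->
  forall r, I01 r -> 0 <= y r.
Proof.
  intros HK Hy Hp Hy0 Hp0 Hq r Hr.
  set (f := fun r => Rmin (y r) 0 ^ 2 + Rmin (p r) 0 ^ 2).
  set (df := fun r => p r * (2 * Rmin (y r) 0) + q r * (2 * Rmin (p r) 0)).
  (* The integrating factor turns [f' <= (1 + K) f] into monotonicity of [g]; as [f] vanishes at 0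
     and is nonnegative, it vanishes throughout. *)
  set (g := fun r => - (f r * exp (- (1 + K) * r))).
  assert (Hg : forall s, I01 s ->
    is_derive g s ((((1 + K) * f s) - df s) * exp (- (1 + K) * s))).
  { intros s Hs.
    assert (Hf : is_derive f s (df s)).
    { apply (is_derive_plus (fun r => Rmin (y r) 0 ^ 2) (fun r => Rmin (p r) 0 ^ 2)).
      - apply (is_derive_comp (fun t => Rmin t 0 ^ 2) y); [apply is_derive_sqr_min0 | auto].
      - apply (is_derive_comp (fun t => Rmin t 0 ^ 2) p); [apply is_derive_sqr_min0 | auto]. }
    unfold g. auto_derive; [now exists (df s) | ].
    replace (Derive (fun x => f x) s) with (df s)
      by (symmetry; exact (is_derive_unique _ _ _ Hf)).
    ring. }
  assert (Hle : g 0 <= g r).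
  { apply (derive01_ge0 _ _ Hg); [ | unfold I01; lra | exact Hr | apply Hr].
    intros s Hs. apply Rmult_le_pos; [ | apply Rlt_le, exp_pos].
    pose proof (Hq s Hs) as Hqs. unfold df, f.
    pose proof (Rmin_r (y s) 0). pose proof (Rmin_r (p s) 0).
    pose proof (Rmin_l (p s) 0).
    set (m := Rmin (y s) 0) in *. set (n := Rmin (p s) 0) in *.
    (* Since [m] and [n] are nonpositive, [df <= 2 (1 + K) m n <= (1 + K) (m^2 + n^2)]. *)
    assert (m * p s <= m * n) by nra.
    assert (n * q s <= n * (K * m)) by nra.
    assert (0 <= (1 + K) * (m - n) ^ 2) by (apply Rmult_le_pos; [lra | apply pow2_ge_0]).
    nra. }
  unfold g, f in Hle. rewrite Hy0, Hp0, (Rmin_left 0 0) in Hle by lra.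
  pose proof (exp_pos (- (1 + K) * r)).
  pose proof (pow2_ge_0 (Rmin (y r) 0)). pose proof (pow2_ge_0 (Rmin (p r) 0)).
  assert (Rmin (y r) 0 ^ 2 <= 0) by nra.
  assert (Rmin (y r) 0 = 0) by nra.
  pose proof (Rmin_l (y r) 0). lra.
Qed.

(** As [b <= a], the right-hand side is at least [a (e^y - e^(-y))]. This is nonnegative where
    [y > 0] and bounded below by a multiple of [y] where [y <= 0], as the comparison requires. *)
Lemma sinh_equation_nonneg (a b : R) (y p : R -> R) :
  0 <= b <= a ->
  (forall r, I01 r -> is_derive y r (p r)) ->
  (forall r, I01 r -> is_derive p r (a * exp (y r) - b * exp (- y r))) ->
  y 0 = 0 -> p 0 = 0 ->
  forall r, I01 r -> 0 <= y r.
Proof.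
  intros Hab Hy Hp Hy0 Hp0.
  (* At a minimum point [m] of [y], [exp (- y m)] bounds [exp (- y)] on [0,1]; this yields the
     constant [K]. *)
  destruct (continuity_ab_min y 0 1) as [m [Hm _]]; [lra | | ].
  { intros c Hc. apply continuity_pt_filterlim.
    exact (continuous_derive _ _ _ (Hy c Hc)). }
  assert (HK : 0 <= a * (1 + exp (- y m))).
  { apply Rmult_le_pos; [lra | ]. pose proof (exp_pos (- y m)). lra. }
  apply (second_order_comparison y p _ _ HK Hy Hp Hy0 Hp0).
  intros r Hr.
  assert (Hb : b * exp (- y r) <= a * exp (- y r)).
  { apply Rmult_le_compat_r; [apply Rlt_le, exp_pos | lra]. }
  destruct (Rle_dec (y r) 0) as [Hneg | Hpos].
  - rewrite Rmin_left by exact Hneg.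
    pose proof (exp_ineq1_le (y r)) as H1.
    assert (H2 : exp (y r) * exp (- y r) = 1).
    { rewrite <- exp_plus. replace (y r + - y r) with 0 by ring. apply exp_0. }
    pose proof (exp_pos (- y r)).
    assert (H3 : exp (- y r) <= exp (- y m)).
    { destruct (Hm r Hr) as [Hlt | ->]; [ | lra]. apply Rlt_le, exp_increasing. lra. }
    (* Multiply [1 + y <= e^y] by [e^(-y)], then use [y <= 0] and the bound at [m]. *)
    assert (H4 : exp (- y r) <= 1 - y r * exp (- y m)) by nra.
    assert (a * (y r * (1 + exp (- y m))) <= a * (exp (y r) - exp (- y r))).
    { apply Rmult_le_compat_l; lra. }
    lra.
  - rewrite Rmin_right by lra.
    assert (exp (- y r) < exp (y r)) by (apply exp_increasing; lra).
    nra.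
Qed.

(** * A single solution: energy, order of the coefficients, monotonicity ([mu = 0] included) *)

Section MeanField.

Variables (mu lambda a b : R) (y p E F : R -> R).
Hypothesis Hmu : 0 <= mu < lambda.
Hypothesis H : mean_field mu lambda a b y p E F.

Lemma mean_field_E1_gt0 : 0 < E 1.
Proof.
  destruct H. apply (primitive01_gt0 E (fun r => exp (y r))); auto using exp_pos.
Qed.

Lemma mean_field_F1_gt0 : 0 < F 1.
Proof.
  destruct H. apply (primitive01_gt0 F (fun r => exp (- y r))); auto using exp_pos.
Qed.

Lemma mean_field_a_ge0 : 0 <= a.
Proof.
  pose proof mean_field_E1_gt0. pose proof (mf_E1 _ _ _ _ _ _ _ _ H). nra.
Qed.

Lemma mean_field_b_gt0 : 0 < b.
Proof.
  pose proof mean_field_F1_gt0. pose proof (mf_F1 _ _ _ _ _ _ _ _ H). nra.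
Qed.

(** Both sides vanish at 0 and have the same derivative. At [r = 1] this gives
    [p 1 = mu - lambda]. *)
Lemma mean_field_p_eq (r : R) : I01 r -> p r = a * E r - b * F r.
Proof.
  destruct H as [Dy Dp DE DF y0 p0 E0 F0 E1 F1]. intros Hr.
  enough (p r - (a * E r - b * F r) = p 0 - (a * E 0 - b * F 0)).
  { rewrite p0, E0, F0 in *. lra. }
  apply (derive01_0 (fun r => p r - (a * E r - b * F r))); [ | exact Hr].
  intros s Hs. auto_derive.
  - repeat split; eexists; eauto.
  - rewrite (is_derive_unique (fun x : R => p x) _ _ (Dp s Hs)),
      (is_derive_unique (fun x : R => E x) _ _ (DE s Hs)),
      (is_derive_unique (fun x : R => F x) _ _ (DF s Hs)). ring.
Qed.

(** Multiplying [y'' = a e^y - b e^(-y)] by [y'] and integrating from 0, where both sides vanish. *)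
Lemma mean_field_energy (r : R) :
  I01 r -> p r ^ 2 / 2 = a * (exp (y r) - 1) + b * (exp (- y r) - 1).
Proof.
  destruct H as [Dy Dp DE DF y0 p0 E0 F0 E1 F1]. intros Hr.
  set (h := fun r => p r ^ 2 / 2 - (a * (exp (y r) - 1) + b * (exp (- y r) - 1))).
  enough (h r = h 0) as Hh.
  { unfold h in Hh. rewrite y0, p0, Ropp_0, exp_0 in Hh. lra. }
  apply derive01_0; [ | exact Hr].
  intros s Hs. unfold h. auto_derive.
  - repeat split; eexists; eauto.
  - rewrite (is_derive_unique (fun x : R => p x) _ _ (Dp s Hs)),
      (is_derive_unique (fun x : R => y x) _ _ (Dy s Hs)). field.
Qed.

Lemma mean_field_a_lt_b : a < b.
Proof.
  pose proof mean_field_b_gt0. pose proof mean_field_a_ge0.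
  destruct H as [Dy Dp DE DF y0 p0 E0 F0 E1 F1].
  apply Rnot_le_lt. intros Hba.
  assert (Hy : forall r, I01 r -> 0 <= y r).
  { apply (sinh_equation_nonneg a b y p); auto; lra. }
  (* From [y >= 0] follows [F 1 <= E 1], so [lambda = b F 1 <= a E 1 = mu], a contradiction. *)
  assert (HEF : E 0 - F 0 <= E 1 - F 1).
  { apply (derive01_ge0 (fun r => E r - F r) (fun r => exp (y r) - exp (- y r)));
      try (unfold I01; lra).
    - intros r Hr. apply (is_derive_minus E F); auto.
    - intros r Hr. specialize (Hy r Hr).
      destruct (Req_dec (y r) 0) as [-> | Hne]; [rewrite Ropp_0; lra | ].
      assert (exp (- y r) < exp (y r)) by (apply exp_increasing; lra). lra. }
  pose proof mean_field_E1_gt0. pose proof mean_field_F1_gt0.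
  rewrite E0, F0 in HEF. nra.
Qed.

Lemma mean_field_p_lt0 (r : R) : 0 < r <= 1 -> p r < 0.
Proof.
  pose proof mean_field_b_gt0. pose proof mean_field_a_ge0. pose proof mean_field_a_lt_b.
  destruct H as [Dy Dp DE DF y0 p0 E0 F0 E1 F1]. intros Hr.
  assert (Hy : forall r, I01 r -> 0 <= - y r).
  { apply (sinh_equation_nonneg b a (fun r => - y r) (fun r => - p r)); try lra.
    - intros s Hs. apply (is_derive_opp y); auto.
    - intros s Hs. rewrite Ropp_involutive.
      replace (b * exp (- y s) - a * exp (y s))
        with (- (a * exp (y s) - b * exp (- y s))) by ring.
      apply (is_derive_opp p); auto. }
  enough (- p 0 < - p r) by lra.
  apply (derive01_gt0 (fun r => - p r) (fun r => - (a * exp (y r) - b * exp (- y r))));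
    try (unfold I01; lra).
  - intros s Hs. apply (is_derive_opp p); auto.
  - intros s Hs. specialize (Hy s ltac:(unfold I01; lra)).
    assert (exp (y s) <= exp (- y s)).
    { destruct (Req_dec (y s) 0) as [-> | Hne]; [rewrite Ropp_0; lra | ].
      apply Rlt_le, exp_increasing. lra. }
    pose proof (exp_pos (- y s)). nra.
Qed.

Lemma mean_field_decreasing : decreasing01 y.
Proof.
  intros r s Hr Hs Hrs. enough (- y r < - y s) by lra.
  apply (derive01_gt0 (fun r => - y r) (fun r => - p r)); auto.
  - intros t Ht. apply (is_derive_opp y), (mf_y _ _ _ _ _ _ _ _ H); auto.
  - intros t Ht. pose proof (mean_field_p_lt0 t). lra.
Qed.

End MeanField.

(** * Sign changes and the derivative at the crossing *)

(** Take for [z] the supremum of the points up to which [g] stays negative. Continuity forces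
    [g z = 0]; as [g] is negative just before [z], left difference quotients there are positive. *)
Lemma first_upcrossing (g dg : R -> R) (x y : R) :
  x < y -> (forall r, x <= r <= y -> is_derive g r (dg r)) -> g x < 0 <= g y ->
  exists z, x < z <= y /\ g z = 0 /\ 0 <= dg z.
Proof.
  intros Hxy Hg Hgxy.
  assert (Cg : forall r, x <= r <= y -> forall eps, 0 < eps -> exists d, 0 < d /\
    forall t, Rabs (t - r) < d -> Rabs (g t - g r) < eps).
  { intros r Hr eps Heps.
    destruct (proj1 (filterlim_locally _ _) (continuous_derive _ _ _ (Hg r Hr))
      (mkposreal eps Heps)) as [d Hd].
    exists d. split; [apply cond_pos | exact Hd]. }
  set (S := fun t => x <= t <= y /\ forall s, x <= s <= t -> g s < 0).
  assert (Sx : S x).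
  { split; [lra | ]. intros s Hs. replace s with x by lra. lra. }
  destruct (completeness S) as [z [Hub Hlub]].
  { exists y. intros t [Ht _]. lra. }
  { now exists x. }
  assert (Hz : x <= z <= y).
  { split; [now apply Hub | apply Hlub; intros t [Ht _]; lra]. }
  assert (Hbelow : forall s, x <= s < z -> g s < 0).
  { intros s Hs. apply NNPP. intros Hn.
    apply (Rlt_not_le z s); [lra | ]. apply Hlub. intros t [Ht Hneg].
    apply Rnot_lt_le. intros Hst. apply Hn, Hneg. lra. }
  assert (Hz0 : ~ g z < 0).
  (* If [g z < 0], negativity would persist beyond [z], against its being an upper bound of [S]. *)
  { intros Hneg. destruct (Cg z Hz (- g z)) as [d [Hd Hc]]; [lra | ].
    assert (Hzy : z < y).
    { destruct (Req_dec z y) as [-> | ]; lra. }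
    set (e := Rmin (d / 2) (y - z)).
    assert (He : 0 < e <= y - z /\ e < d).
    { unfold e, Rmin; destruct Rle_dec; lra. }
    enough (S (z + e)) as HS by (apply Hub in HS; lra).
    split; [lra | ]. intros s Hs. destruct (Rlt_le_dec s z).
    - apply Hbelow. lra.
    - assert (Hs' : Rabs (g s - g z) < - g z) by (apply Hc, Rabs_def1; lra).
      apply Rabs_def2 in Hs'. lra. }
  assert (Hxz : x < z).
  { destruct (Req_dec x z) as [-> | ]; lra. }
  assert (Hz1 : ~ 0 < g z).
  { intros Hpos. destruct (Cg z Hz (g z)) as [d [Hd Hc]]; [lra | ].
    set (e := Rmin (d / 2) (z - x)).
    assert (He : 0 < e <= z - x /\ e < d).
    { unfold e, Rmin; destruct Rle_dec; lra. }
    assert (Hs' : Rabs (g (z - e) - g z) < g z) by (apply Hc, Rabs_def1; lra).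
    apply Rabs_def2 in Hs'. specialize (Hbelow (z - e)). lra. }
  exists z. split; [lra | split; [lra | ]].
  apply Rnot_lt_le. intros Hl.
  destruct (proj1 (is_derive_Reals _ _ _) (Hg z Hz) (- dg z)) as [d Hd]; [lra | ].
  pose proof (cond_pos d).
  set (e := Rmin (d / 2) (z - x)).
  assert (He : 0 < e <= z - x /\ e < d).
  { unfold e, Rmin; destruct Rle_dec; lra. }
  specialize (Hd (- e) ltac:(lra)).
  rewrite Rabs_Ropp, Rabs_pos_eq in Hd by lra.
  specialize (Hd ltac:(lra)). apply Rabs_def2 in Hd.
  specialize (Hbelow (z - e) ltac:(lra)).
  replace (z + - e) with (z - e) in Hd by ring.
  assert (0 < (g (z - e) - g z) / - e).
  { replace ((g (z - e) - g z) / - e) with ((g z - g (z - e)) / e) by (field; lra).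
    apply Rdiv_lt_0_compat; lra. }
  lra.
Qed.

(** The reflection [r -> -r] makes this a first upcrossing. *)
Lemma last_downcrossing (g dg : R -> R) (x y : R) :
  x < y -> (forall r, x <= r <= y -> is_derive g r (dg r)) -> g y < 0 <= g x ->
  exists z, x <= z < y /\ g z = 0 /\ dg z <= 0.
Proof.
  intros Hxy Hg Hgxy.
  destruct (first_upcrossing (fun r => g (- r)) (fun r => - dg (- r)) (- y) (- x))
    as [z [Hz [Hz0 Hz1]]].
  - lra.
  - intros r Hr. assert (Hgr : is_derive g (- r) (dg (- r))) by (apply Hg; lra).
    auto_derive; [now exists (dg (- r)) | ].
    rewrite (is_derive_unique (fun x : R => g x) _ _ Hgr). ring.
  - rewrite !Ropp_involutive. exact Hgxy.
  - exists (- z). split; [lra | split; [exact Hz0 | lra]].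
Qed.

(** * The difference of the two solutions *)

Section Difference.

Variables (mu lambda a b c : R) (y p E F : R -> R) (a0 : R) (z q G K : R -> R).
Hypothesis Hmu : 0 < mu < lambda.
Hypothesis Hy : mean_field mu lambda a b y p E F.
Hypothesis Hz : mean_field 0 lambda a0 c z q G K.

(** The second derivative of [y - z], simplified by [a0 = 0]. *)
Let ddw (r : R) : R := a * exp (y r) - b * exp (- y r) + c * exp (- z r).

Lemma mean_field_a_eq0 : a0 = 0.
Proof.
  pose proof (mean_field_E1_gt0 _ _ _ _ _ _ _ _ Hz).
  pose proof (mf_E1 _ _ _ _ _ _ _ _ Hz). nra.
Qed.

Lemma difference_is_derive (r : R) : I01 r -> is_derive (fun t => y t - z t) r (p r - q r).
Proof.
  intros Hr. apply (is_derive_minus y z).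
  - now apply (mf_y _ _ _ _ _ _ _ _ Hy).
  - now apply (mf_y _ _ _ _ _ _ _ _ Hz).
Qed.

Lemma difference_is_derive2 (r : R) : I01 r -> is_derive (fun t => p t - q t) r (ddw r).
Proof.
  intros Hr. unfold ddw.
  replace (a * exp (y r) - b * exp (- y r) + c * exp (- z r))
    with ((a * exp (y r) - b * exp (- y r)) - (a0 * exp (z r) - c * exp (- z r)))
    by (rewrite mean_field_a_eq0; ring).
  apply (is_derive_minus p q).
  - now apply (mf_p _ _ _ _ _ _ _ _ Hy).
  - now apply (mf_p _ _ _ _ _ _ _ _ Hz).
Qed.

(* Subtracting the two energy identities eliminates [z]: at a critical point
   of [y - z] the second derivative depends on [y] alone, monotonically. *)
Lemma difference_critical (r : R) :
  I01 r -> p r - q r = 0 -> ddw r = 2 * a * exp (y r) + c - a - b.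
Proof.
  intros Hr Hpq.
  pose proof (mean_field_energy _ _ _ _ _ _ _ _ Hy r Hr) as Ey.
  pose proof (mean_field_energy _ _ _ _ _ _ _ _ Hz r Hr) as Ez.
  rewrite mean_field_a_eq0 in Ez. replace (q r) with (p r) in Ez by lra.
  unfold ddw. lra.
Qed.

Lemma mean_field_a_gt0 : 0 < a.
Proof.
  pose proof (mean_field_E1_gt0 _ _ _ _ _ _ _ _ Hy).
  pose proof (mf_E1 _ _ _ _ _ _ _ _ Hy). nra.
Qed.

Lemma difference_critical_decr (r s : R) :
  I01 r -> I01 s -> r < s -> p r - q r = 0 -> p s - q s = 0 -> ddw s < ddw r.
Proof.
  intros Hr Hs Hrs Hr0 Hs0. rewrite !difference_critical by assumption.
  assert (exp (y s) < exp (y r)).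
  { apply exp_increasing. apply (mean_field_decreasing mu lambda a b y p E F); auto. lra. }
  pose proof mean_field_a_gt0. nra.
Qed.

Lemma difference_p1 : p 1 - q 1 = mu.
Proof.
  rewrite (mean_field_p_eq _ _ _ _ _ _ _ _ Hy), (mean_field_p_eq _ _ _ _ _ _ _ _ Hz)
    by (unfold I01; lra).
  rewrite (mf_E1 _ _ _ _ _ _ _ _ Hy), (mf_E1 _ _ _ _ _ _ _ _ Hz).
  rewrite (mf_F1 _ _ _ _ _ _ _ _ Hy), (mf_F1 _ _ _ _ _ _ _ _ Hz). ring.
Qed.

Lemma difference_p_ge0 (s : R) : I01 s -> 0 <= p s - q s.
Proof.
  intros Hs. apply Rnot_lt_le. intros Hneg.
  assert (H0 : p 0 - q 0 = 0).
  { rewrite (mf_p0 _ _ _ _ _ _ _ _ Hy), (mf_p0 _ _ _ _ _ _ _ _ Hz). ring. }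
  pose proof difference_p1 as H1.
  assert (Hs01 : 0 < s < 1).
  { unfold I01 in Hs. destruct (Req_dec s 0) as [-> | ]; [lra | ].
    destruct (Req_dec s 1) as [-> | ]; lra. }
  (* A negative value at [s] lies between a downcrossing [r1] (possibly 0) and an upcrossing [r2].
     There [ddw r1 <= 0 <= ddw r2], whereas [ddw] strictly decreases between critical points. *)
  destruct (first_upcrossing (fun t => p t - q t) ddw s 1) as [r2 [Hr2 [Z2 D2]]].
  { lra. }
  { intros r Hr. apply difference_is_derive2. unfold I01; lra. }
  { lra. }
  destruct (last_downcrossing (fun t => p t - q t) ddw 0 s) as [r1 [Hr1 [Z1 D1]]].
  { lra. }
  { intros r Hr. apply difference_is_derive2. unfold I01; lra. }
  { lra. }
  pose proof (difference_critical_decr r1 r2) as Hd. unfold I01 in Hd. lra.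
Qed.

Lemma difference_nondecreasing (r s : R) :
  I01 r -> I01 s -> r <= s -> y r - z r <= y s - z s.
Proof.
  apply (derive01_ge0 (fun t => y t - z t) (fun t => p t - q t)).
  - exact difference_is_derive.
  - exact difference_p_ge0.
Qed.

(** Equal values at [r < s] would make [y - z] constant in between. Then every intermediate point is
    critical with [ddw = 0], against the strict decrease of [ddw] along critical points. *)
Lemma difference_increasing : increasing01 (fun r => y r - z r).
Proof.
  intros r s Hr Hs Hrs. apply Rnot_le_lt. intros Hle.
  assert (Hcst : forall t, r <= t <= s -> y t - z t = y r - z r).
  { intros t Ht. assert (It : I01 t) by (unfold I01 in *; lra).
    pose proof (difference_nondecreasing r t Hr It ltac:(lra)).
    pose proof (difference_nondecreasing t s It Hs ltac:(lra)). lra. }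
  assert (Hloc : forall t (f : R -> R) k l, r < t < s ->
    (forall x, r < x < s -> f x = k) -> is_derive f t l -> l = 0).
  { intros t f k l Ht Hf Hd. apply is_derive_unique in Hd. rewrite <- Hd.
    rewrite (Derive_ext_loc f (fun _ => k)); [apply Derive_const | ].
    exists (mkposreal (Rmin (t - r) (s - t)) ltac:(apply Rmin_pos; lra)).
    intros x Hx. change (Rabs (x - t) < Rmin (t - r) (s - t)) in Hx.
    apply Rabs_def2 in Hx.
    pose proof (Rmin_l (t - r) (s - t)). pose proof (Rmin_r (t - r) (s - t)).
    apply Hf. lra. }
  assert (Hpq : forall t, r < t < s -> p t - q t = 0).
  { intros t Ht. apply (Hloc t (fun t => y t - z t) (y r - z r)); auto.
    - intros x Hx. apply Hcst. lra.
    - apply difference_is_derive. unfold I01 in *; lra. }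
  assert (Hdd : forall t, r < t < s -> ddw t = 0).
  { intros t Ht. apply (Hloc t (fun t => p t - q t) 0); auto.
    apply difference_is_derive2. unfold I01 in *; lra. }
  set (t1 := (2 * r + s) / 3). set (t2 := (r + 2 * s) / 3).
  assert (Ht : r < t1 < t2 /\ t2 < s) by (unfold t1, t2; lra).
  pose proof (difference_critical_decr t1 t2) as Hd. unfold I01 in *.
  rewrite !Hpq, !Hdd in Hd by lra. lra.
Qed.

(* [p - q - a E] vanishes at both ends of [0,1] and first decreases, then increases. *)
Lemma difference_p_le (r : R) : I01 r -> p r - q r <= mu.
Proof.
  intros Hr.
  assert (HE : a * E r <= mu).
  { rewrite <- (mf_E1 _ _ _ _ _ _ _ _ Hy). apply Rmult_le_compat_l.
    - apply Rlt_le, mean_field_a_gt0.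
    - apply (derive01_ge0 E (fun t => exp (y t))); try (unfold I01 in *; lra).
      + exact (mf_E _ _ _ _ _ _ _ _ Hy).
      + intros t _. apply Rlt_le, exp_pos. }
  apply Rle_trans with (2 := HE).
  set (phi := fun t => p t - q t - a * E t).
  set (dphi := fun t => exp (- y t) * (c * exp (y t - z t) - b)).
  assert (Hphi : forall t, I01 t -> is_derive phi t (dphi t)).
  { intros t Ht. unfold phi, dphi.
    replace (exp (- y t) * (c * exp (y t - z t) - b)) with (ddw t - a * exp (y t)).
    - apply (is_derive_minus (fun t => p t - q t) (fun t => a * E t)).
      + now apply difference_is_derive2.
      + apply (is_derive_scal E). now apply (mf_E _ _ _ _ _ _ _ _ Hy).
    - unfold ddw. replace (- z t) with (- y t + (y t - z t)) by ring.
      rewrite exp_plus. ring. }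
  assert (P0 : phi 0 = 0).
  { unfold phi. rewrite (mf_p0 _ _ _ _ _ _ _ _ Hy), (mf_p0 _ _ _ _ _ _ _ _ Hz),
      (mf_E0 _ _ _ _ _ _ _ _ Hy). ring. }
  assert (P1 : phi 1 = 0).
  { unfold phi. rewrite (mf_E1 _ _ _ _ _ _ _ _ Hy). pose proof difference_p1. lra. }
  enough (phi r <= 0) by (unfold phi in *; lra).
  apply Rnot_lt_le. intros Hpos. unfold I01 in Hr.
  assert (Hr01 : 0 < r < 1).
  { destruct (Req_dec r 0) as [-> | ]; [lra | ].
    destruct (Req_dec r 1) as [-> | ]; lra. }
  (* If [phi r > 0], [phi'] is positive at some [s < r] and negative at some [t > r]. Hence
     [c e^(y - z)] exceeds [b] at [s] but not at [t], although [y - z] increases. *)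
  destruct (MVT01 phi dphi 0 r Hphi) as [s [Hs Es]]; try (unfold I01; lra).
  destruct (MVT01 phi dphi r 1 Hphi) as [t [Ht Et]]; try (unfold I01; lra).
  assert (Ds : 0 < dphi s) by nra. assert (Dt : dphi t < 0) by nra.
  unfold dphi in Ds, Dt.
  pose proof (exp_pos (- y s)). pose proof (exp_pos (- y t)).
  assert (b < c * exp (y s - z s)) by nra.
  assert (c * exp (y t - z t) < b) by nra.
  assert (0 < c).
  { apply (mean_field_b_gt0 0 lambda a0 c z q G K); [lra | exact Hz]. }
  assert (exp (y s - z s) < exp (y t - z t)).
  { apply exp_increasing. apply difference_increasing; unfold I01; lra. }
  nra.
Qed.

(** Each summand lies in [0,mu]: [p - q] by the previous bounds, and [y - z] because it starts at 0
    with slope [p - q] on an interval of length at most 1. *)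
Lemma difference_bound (r : R) :
  I01 r -> Rabs (y r - z r) + Rabs (p r - q r) <= 2 * mu.
Proof.
  intros Hr. pose proof (difference_p_ge0 r Hr). pose proof (difference_p_le r Hr).
  assert (W0 : y 0 - z 0 = 0).
  { rewrite (mf_y0 _ _ _ _ _ _ _ _ Hy), (mf_y0 _ _ _ _ _ _ _ _ Hz). ring. }
  assert (0 <= y r - z r).
  { rewrite <- W0. apply difference_nondecreasing; unfold I01 in *; lra. }
  assert (y r - z r <= mu).
  { unfold I01 in Hr. destruct (Req_dec r 0) as [-> | ]; [lra | ].
    destruct (MVT01 _ _ 0 r difference_is_derive) as [s [Hs Es]];
      try (unfold I01; lra).
    pose proof (difference_p_le s ltac:(unfold I01; lra)).
    pose proof (difference_p_ge0 s ltac:(unfold I01; lra)). nra. }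
  rewrite !Rabs_pos_eq; lra.
Qed.

End Difference.

(** * The norm and the two limits *)

(** The bound [M] and the value at [r = 0] keep the supremum finite, so [real] returns it and not
    its default value. *)
Lemma C1_norm_bounds (f : R -> R) (M : R) :
  (forall r, I01 r -> Rabs (f r) + Rabs (Derive01 f r) <= M) -> 0 <= C1_norm f <= M.
Proof.
  intros HM. unfold C1_norm.
  set (S := fun s => exists r, I01 r /\ s = Rabs (f r) + Rabs (Derive01 f r)).
  destruct (Lub_Rbar_correct S) as [Hub Hlub].
  assert (H1 : Rbar_le (Lub_Rbar S) M).
  { apply Hlub. intros s [r [Hr ->]]. simpl. auto. }
  assert (H0 : Rbar_le (Rabs (f 0) + Rabs (Derive01 f 0)) (Lub_Rbar S)).
  { apply Hub. exists 0. split; [unfold I01; lra | easy]. }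
  pose proof (Rabs_pos (f 0)). pose proof (Rabs_pos (Derive01 f 0)).
  destruct (Lub_Rbar S); simpl in *; lra.
Qed.

Lemma v_solution_decreasing (mu lambda : R) (v : R -> R) :
  0 <= mu < lambda -> v_solution mu lambda v -> decreasing01 v.
Proof.
  intros Hmu Hv.
  destruct (v_solution_mean_field _ _ _ Hv) as (a & b & y & p & E & F & H & Hyv).
  intros r s Hr Hs. rewrite <- !Hyv by assumption.
  exact (mean_field_decreasing _ _ _ _ _ _ _ _ Hmu H r s Hr Hs).
Qed.

Lemma v_minus_u (mu lambda : R) (v u : R -> R) :
  0 < mu < lambda -> v_solution mu lambda v -> u_solution lambda u ->
  increasing01 (fun r => v r - u r) /\ 0 <= C1_norm (fun r => v r - u r) <= 2 * mu.
Proof.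
  intros Hmu Hv Hu%u_solution_v_solution.
  destruct (v_solution_mean_field _ _ _ Hv) as (a & b & y & p & E & F & Hy & Hyv).
  destruct (v_solution_mean_field _ _ _ Hu) as (a0 & c & z & q & G & K & Hz & Hzu).
  split.
  - intros r s Hr Hs. rewrite <- !Hyv, <- !Hzu by assumption.
    exact (difference_increasing _ _ _ _ _ _ _ _ _ _ _ _ _ _ Hmu Hy Hz r s Hr Hs).
  - apply C1_norm_bounds. intros r Hr.
    (* On [0,1] [v - u] coincides with [y - z], so its relative derivative is the two-sided one,
       [p - q]. *)
    rewrite (is_derive01_Derive01 _ _ (p r - q r) Hr).
    + rewrite <- Hyv, <- Hzu by exact Hr.
      exact (difference_bound _ _ _ _ _ _ _ _ _ _ _ _ _ _ Hmu Hy Hz r Hr).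
    + apply (is_derive01_ext (fun t => y t - z t)); [exact Hr | | ].
      * intros t Ht. now rewrite Hyv, Hzu.
      * apply is_derive_is_derive01.
        exact (difference_is_derive _ _ _ _ _ _ _ _ _ _ _ _ _ _ Hy Hz r Hr).
Qed.

Theorem theorem1p1
  (v : R -> R -> R -> R) (u : R -> R -> R)
  (Hv : forall mu lambda, 0 < mu < lambda -> v_solution mu lambda (v mu lambda))
  (Hu : forall lambda, 0 < lambda -> u_solution lambda (u lambda)) :
  (forall mu lambda, 0 < mu < lambda -> decreasing01 (v mu lambda)) /\
  (forall lambda, 0 < lambda -> decreasing01 (u lambda)) /\
  (forall mu lambda, 0 < mu < lambda ->
     increasing01 (fun r => v mu lambda r - u lambda r)) /\
  (forall mu : R -> R,
     (forall lambda, 0 < lambda -> 0 < mu lambda < lambda) ->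
     is_lim (fun lambda => mu lambda * lambda) p_infty 0 ->
     is_lim (fun lambda => C1_norm (fun r => v (mu lambda) lambda r - u lambda r))
            p_infty 0) /\
  (forall lambda, 0 < lambda ->
     filterlim (fun mu => C1_norm (fun r => v mu lambda r - u lambda r))
               (at_right 0) (locally 0)).
Proof.
  assert (Hw : forall mu lambda, 0 < mu < lambda ->
    increasing01 (fun r => v mu lambda r - u lambda r) /\
    0 <= C1_norm (fun r => v mu lambda r - u lambda r) <= 2 * mu).
  { intros mu lambda Hmu. apply (v_minus_u mu lambda); [exact Hmu | auto | apply Hu; lra]. }
  split; [ | split; [ | split; [ | split]]].
  - intros mu lambda Hmu. apply (v_solution_decreasing mu lambda); [lra | auto].
  - intros lambda Hl. apply (v_solution_decreasing 0 lambda); [lra | ].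
    apply u_solution_v_solution; auto.
  - intros mu lambda Hmu. exact (proj1 (Hw mu lambda Hmu)).
  - intros mu Hmu Hlim. apply is_lim_spec. intros eps.
    destruct (proj2 (is_lim_spec _ _ _) Hlim (pos_div_2 eps)) as [M HM].
    (* For [lambda > 1], [mu < mu * lambda < eps / 2], so the norm is below [eps]. *)
    exists (Rmax M 1). intros lambda Hl.
    pose proof (Rmax_l M 1). pose proof (Rmax_r M 1).
    specialize (HM lambda ltac:(lra)). simpl in HM.
    apply Rabs_def2 in HM.
    specialize (Hmu lambda ltac:(lra)).
    destruct (Hw (mu lambda) lambda Hmu) as [_ HC].
    rewrite Rminus_0_r, Rabs_pos_eq by exact (proj1 HC). nra.
  - intros lambda Hl. apply filterlim_locally. intros eps.
    pose proof (cond_pos eps).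
    (* The radius [lambda] ensures [mu < lambda], under which the bound [2 * mu] is available. *)
    exists (mkposreal (Rmin lambda (eps / 2)) ltac:(apply Rmin_pos; lra)).
    intros mu Hmu Hpos. change (Rabs (mu - 0) < Rmin lambda (eps / 2)) in Hmu.
    rewrite Rminus_0_r, Rabs_pos_eq in Hmu by lra.
    pose proof (Rmin_l lambda (eps / 2)). pose proof (Rmin_r lambda (eps / 2)).
    destruct (Hw mu lambda ltac:(lra)) as [_ HC].
    match goal with |- ball _ _ ?x => change (Rabs (x - 0) < eps) end.
    rewrite Rminus_0_r, Rabs_pos_eq by exact (proj1 HC). lra.
Qed.
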